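(* Given a threshold automaton $\mathsf{TA}=(\mathcal L,\mathcal I,\Gamma,\mathcal R)$ over an environment $(\Pi,RC,N)$, there is an existential Presburger arithmetic formula $\phi_{\mathit{reach}}$ with $2|\mathcal L|+2|\Gamma|+2|\Pi|$ free variables such that for all configurations $\sigma,\sigma'$ of $\mathsf{TA}$, $\phi_{\mathit{reach}}(\sigma,\sigma')$ holds if and only if $\sigma'$ is reachable from $\sigma$.
   Context: An environment is $\mathit{Env}=(\Pi,RC,N)$: $\Pi$ a finite set of parameters over $\mathbb N_0$, $RC\subseteq\mathbb N_0^\Pi$ integer-linear-definable, $N\colon RC\to\mathbb N_0$ linear. A threshold automaton over $\mathit{Env}$ is $\mathsf{TA}=(\mathcal L,\mathcal I,\Gamma,\mathcal R)$: finite locations $\mathcal L$, initial locations $\mathcal I\subseteq\mathcal L$, finite shared variables $\Gamma$ over $\mathbb N_0$, finite rules $r=(r.\mathit{from},r.\mathit{to},r.\varphi,r.\vec u)$ with $r.\varphi$ a conjunction of threshold guards and $r.\vec u\in\{0,1\}^\Gamma$. A threshold guard is $x\ge a_0+\sum_ia_ip_i$ or $x<a_0+\sum_ia_ip_i$ with $x\in\Gamma$, $p_i\in\Pi$, $a_i\in\mathbb Q$. A configuration $\sigma=(\sigma.\kappa,\sigma.\vec g,\sigma.\vec p)$ has $\sigma.\kappa\colon\mathcal L\to\mathbb N_0$, $\sigma.\vec g\in\mathbb N_0^\Gamma$, $\sigma.\vec p\in RC$, $\sum_\ell\sigma.\kappa(\ell)=N(\sigma.\vec p)$; it is encoded by $|\mathcal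 L|+|\Gamma|+|\Pi|$ numbers. $\sigma$ enables $r$ if $\sigma.\kappa(r.\mathit{from})>0$ and $(\sigma.\vec g,\sigma.\vec p)$ satisfies $r.\varphi$; then $r(\sigma)$ keeps parameters, has shared values $\sigma.\vec g+r.\vec u$, and moves one process from $r.\mathit{from}$ to $r.\mathit{to}$. $\sigma'$ is reachable from $\sigma$ if some finite sequence of rules, each enabled in the current configuration, leads from $\sigma$ to $\sigma'$. *)

(* Defs.v *)
From HB Require Import structures.
From mathcomp Require Import all_boot all_order all_algebra.

Set Implicit Arguments.
Unset Strict Implicit.
Unset Printing Implicit Defensive.

Import Order.TTheory GRing.Theory Num.Theory.

Section Presburger.
Variable V : Type.

Inductive lterm : Type :=
  | TVar of V
  | TCst of int
  | TAdd of lterm & lterm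
  | TScale of int & lterm.

Inductive qformula : Type :=
  | FEq of lterm & lterm
  | FLe of lterm & lterm
  | FAnd of qformula & qformula
  | FOr of qformula & qformula
  | FNot of qformula.

(* Variables range over the natural numbers, while terms take integer values, *)
(* so that negative coefficients have their usual meaning.                    *)
Fixpoint lterm_eval (v : V -> nat) (t : lterm) : int :=
  match t with
  | TVar x => (v x)%:Z
  | TCst c => c
  | TAdd t1 t2 => (lterm_eval v t1 + lterm_eval v t2)%R
  | TScale c t1 => (c * lterm_eval v t1)%R
  end.

Fixpoint qformula_eval (v : V -> nat) (f : qformula) : bool :=
  match f with
  | FEq t1 t2 => lterm_eval v t1 == lterm_eval v t2
  | FLe t1 t2 => (lterm_eval v t1 <= lterm_eval v t2)%R
  | FAnd f1 f2 => qformula_eval v f1 && qformula_eval v f2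
  | FOr f1 f2 => qformula_eval v f1 || qformula_eval v f2
  | FNot f1 => ~~ qformula_eval v f1
  end.

End Presburger.

(* The formula "exists z_0 ... z_(k-1), body", whose free variables are the   *)
(* elements of V (represented by inl); the bound z_i is represented by inr i. *)
Record epformula (V : Type) := EPFormula {
  ep_bound : nat;
  ep_body : qformula (V + 'I_ep_bound)
}.

Definition ep_sat (V : Type) (v : V -> nat) (f : epformula V) : Prop :=
  exists z : 'I_(ep_bound f) -> nat,
    qformula_eval
      (fun x : V + 'I_(ep_bound f) =>
         match x with inl y => v y | inr i => z i end)
      (ep_body f).

(* The sets defined by existential formulas are all the Presburger-definable  *)
(* ones; quantifier-free definitions of RC are the case ep_bound = 0.         *)
(* The values of env_N outside env_RC are irrelevant. Rational coefficients   *)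
(* and a constant term are allowed in env_N.                                  *)
Record environment (P : finType) := Environment {
  env_RC : {ffun P -> nat} -> Prop;
  env_RC_definable : exists f : epformula P,
    forall p : {ffun P -> nat}, env_RC p <-> ep_sat p f;
  env_N : {ffun P -> nat} -> nat;
  env_N_linear : exists (a0 : rat) (a : {ffun P -> rat}),
    forall p : {ffun P -> nat}, env_RC p ->
      ((env_N p)%:R = a0 + \sum_(i : P) a i * (p i)%:R :> rat)%R
}.

(* Rise x a0 a is x >= a0 + \sum_i a_i p_i; Fall x a0 a is its negation.      *)
Inductive guard (G P : finType) : Type :=
  | Rise of G & rat & {ffun P -> rat}
  | Fall of G & rat & {ffun P -> rat}.

Section GuardCountable.
Variables G P : finType.

Definition guard_code (c : guard G P) : bool * G * rat * {ffun P -> rat} :=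
  match c with
  | Rise x a0 a => (true, x, a0, a)
  | Fall x a0 a => (false, x, a0, a)
  end.

Definition guard_decode (u : bool * G * rat * {ffun P -> rat}) : guard G P :=
  let: (b, x, a0, a) := u in if b then Rise x a0 a else Fall x a0 a.

Lemma guard_codeK : cancel guard_code guard_decode.
Proof. by case. Qed.

HB.instance Definition _ := Countable.copy (guard G P) (can_type guard_codeK).

End GuardCountable.

(* The guard of a rule is the conjunction of the list r_guard, and the update *)
(* vector in {0,1}^G is encoded by booleans, which coerce to nat.             *)
Record rule (L G P : finType) := Rule {
  r_from : L;
  r_to : L;
  r_guard : seq (guard G P);
  r_upd : {ffun G -> bool}
}.

Section RuleCountable.
Variables L G P : finType.

Definition rule_code (r : rule L G P) :=
  (r_from r, r_to r, r_guard r, r_upd r).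

Definition rule_decode (u : L * L * seq (guard G P) * {ffun G -> bool}) :=
  let: (l, l', c, w) := u in Rule l l' c w.

Lemma rule_codeK : cancel rule_code rule_decode.
Proof. by case. Qed.

HB.instance Definition _ := Countable.copy (rule L G P) (can_type rule_codeK).

End RuleCountable.

Record threshold_automaton (L G P : finType) := ThresholdAutomaton {
  ta_init : {set L};
  ta_rules : seq (rule L G P)
}.

Record conf (L G P : finType) := Conf {
  kappa : {ffun L -> nat};
  gval : {ffun G -> nat};
  pval : {ffun P -> nat}
}.

Section Semantics.
Variables L G P : finType.
Implicit Types (s : conf L G P) (r : rule L G P).

Definition is_configuration (E : environment P) s : Prop :=
  env_RC E (pval s) /\ \sum_(l : L) kappa s l = env_N E (pval s).

Definition threshold s (a0 : rat) (a : {ffun P -> rat}) : rat :=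
  (a0 + \sum_(i : P) a i * (pval s i)%:R)%R.

Definition guard_holds s (c : guard G P) : bool :=
  match c with
  | Rise x a0 a => (threshold s a0 a <= (gval s x)%:R)%R
  | Fall x a0 a => ((gval s x)%:R < threshold s a0 a)%R
  end.

Definition enabled s r : bool :=
  (0 < kappa s (r_from r)) && all (guard_holds s) (r_guard r).

(* The subtraction truncates only if r is not enabled in s; when r is enabled *)
(* and r_from r = r_to r, kappa is unchanged.                                 *)
Definition fire r s : conf L G P :=
  Conf [ffun l => kappa s l - (l == r_from r) + (l == r_to r)]
       [ffun x => gval s x + r_upd r x]
       (pval s).

Variable TA : threshold_automaton L G P.

Fixpoint run s (rs : seq (rule L G P)) s' : Prop :=
  if rs is r :: rs' then
    [/\ r \in ta_rules TA, enabled s r & run (fire r s) rs' s']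
  else s = s'.

Definition reachable s s' : Prop := exists rs : seq (rule L G P), run s rs s'.

End Semantics.

Section Encoding.
Variables L G P : finType.

Definition encode (s : conf L G P) : seq nat :=
  codom (kappa s) ++ codom (gval s) ++ codom (pval s).

Lemma size_encode2 (s s' : conf L G P) :
  size (encode s ++ encode s') == 2 * #|L| + 2 * #|G| + 2 * #|P|.
Proof.
by rewrite !size_cat !size_codom -!mulnDr mul2n -addnn !addnA.
Qed.

Definition encode2 (s s' : conf L G P) :
  (2 * #|L| + 2 * #|G| + 2 * #|P|).-tuple nat := Tuple (size_encode2 s s').

End Encoding.

(* Main.v *)
(* Guards are monotone along a run, so a run changes the set of valid guards  *)
(* at most once per guard: it is a bounded alternation of steady segments and *)
(* single steps. A steady segment that fires each rule r exactly x r times    *)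
(* exists iff x satisfies the flow equations and every used rule is connected *)
(* by used rules to an initially occupied location. Connectivity is certified *)
(* by an existentially quantified rank function on locations.                 *)
Require Import Defs.
From mathcomp Require Import all_boot all_order all_algebra.
From mathcomp Require Import zify.

Set Implicit Arguments.
Unset Strict Implicit.
Unset Printing Implicit Defensive.

Import Order.TTheory GRing.Theory Num.Theory.

(** Along a run the parameters are constant and the shared variables never decrease, so a true
    [Rise] guard stays true and a false [Fall] guard stays false. Each guard thus changes its truth
    value at most once, and at most [size (guards TA)] steps of a run change any of them
    ([run_alternation]).

    For the segments between such steps only the firing counts [x r] of the rules matter. A segment
    from [s] to [s'] forces the flow equation at every location, the equation of every shared
    variable, the guards of the used rules, and a chain of used rules from an initially occupied
    location to each used source ([steady_cons]). Conversely these conditions suffice ([realize]):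
    some used rule can be fired last without breaking the chains ([last_rule]), and induction on the
    number of firings disposes of the others.

    Connectivity is a graph property, but a rank that strictly increases along the chains reduces it
    to comparisons of variables. A segment is therefore quantifier-free definable from its end
    points, counts and ranks ([qf_def_steady]). Composing a number of segments and steps that
    depends only on [TA], with the intermediate configurations bound existentially ([rel_def_comp]),
    yields the formula, and [reachableP] says that it captures reachability. *)

Section Definability.

(** * Quantifier-free definable predicates and their closure properties *)

Variable V : Type.
Implicit Types (v : V -> nat) (q : (V -> nat) -> bool).

(* The integer D clears the denominators of the rational expression e. *)
Definition linear_def (e : (V -> nat) -> rat) : Prop :=
  exists (t : lterm V) (D : int), (0 < D)%R /\
    forall v, ((lterm_eval v t)%:~R = D%:~R * e v)%R.

(** Definability is a property of the semantic predicate, so the boolean conditions of the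
    combinatorial argument become formulas through closure lemmas, without being written again as
    syntax. *)
Definition qf_def q : Prop :=
  exists f : qformula V, forall v, qformula_eval v f = q v.

Lemma eq_linear_def (e e' : (V -> nat) -> rat) :
  e =1 e' -> linear_def e -> linear_def e'.
Proof.
by move=> ee' [t [D [D0 tP]]]; exists t, D; split=> // v; rewrite tP ee'.
Qed.

Lemma linear_def_cst (a : rat) : linear_def (fun=> a).
Proof.
exists (TCst V (numq a)), (denq a); split=> // v /=.
by rewrite numqE mulrC.
Qed.

Lemma linear_def_var (x : V) : linear_def (fun v => (v x)%:R%R).
Proof. by exists (TVar x), 1%R; split=> // v /=; rewrite mul1r. Qed.

Lemma linear_def_add (e e' : (V -> nat) -> rat) :
  linear_def e -> linear_def e' -> linear_def (fun v => e v + e' v)%R.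
Proof.
move=> [t [D [D0 tP]]] [t' [D' [D'0 t'P]]].
exists (TAdd (TScale D' t) (TScale D t')), (D * D')%R; split=> [|v /=].
  exact: mulr_gt0.
by rewrite rmorphD !rmorphM /= tP t'P mulrDr mulrA (mulrC D'%:~R)%R !mulrA.
Qed.

Lemma linear_def_scale (a : rat) (e : (V -> nat) -> rat) :
  linear_def e -> linear_def (fun v => a * e v)%R.
Proof.
move=> [t [D [D0 tP]]]; exists (TScale (numq a) t), (denq a * D)%R.
split=> [|v /=]; first exact: mulr_gt0.
by rewrite !rmorphM /= tP numqE (mulrC a) mulrACA.
Qed.

Lemma linear_def_sum (I : finType) (A : pred I) (e : I -> (V -> nat) -> rat) :
  (forall i, linear_def (e i)) -> linear_def (fun v => \sum_(i | A i) e i v)%R.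
Proof.
move=> eP; elim: (index_enum I) => [|i r IH].
  by apply: eq_linear_def (linear_def_cst 0) => v; rewrite big_nil.
case Ai: (A i); last first.
  by apply: eq_linear_def IH => v; rewrite big_cons Ai.
by apply: eq_linear_def (linear_def_add (eP i) IH) => v; rewrite big_cons Ai.
Qed.

Lemma eq_qf_def q q' : q =1 q' -> qf_def q -> qf_def q'.
Proof. by move=> qq' [f fP]; exists f => v; rewrite fP qq'. Qed.

Lemma qf_def_le (e e' : (V -> nat) -> rat) :
  linear_def e -> linear_def e' -> qf_def (fun v => e v <= e' v)%R.
Proof.
move=> [t [D [D0 tP]]] [t' [D' [D'0 t'P]]].
(* Each side is scaled by the denominator of the other; both denominators are positive, so the order
   is preserved. *)
exists (FLe (TScale D' t) (TScale D t')) => v /=.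
rewrite -(ler_int rat) !rmorphM /= tP t'P mulrCA.
by rewrite !ler_pM2l // ltr0z.
Qed.

Lemma qf_def_not q : qf_def q -> qf_def (fun v => ~~ q v).
Proof. by move=> [f fP]; exists (FNot f) => v /=; rewrite fP. Qed.

Lemma qf_def_and q q' :
  qf_def q -> qf_def q' -> qf_def (fun v => q v && q' v).
Proof.
by move=> [f fP] [f' f'P]; exists (FAnd f f') => v /=; rewrite fP f'P.
Qed.

Lemma qf_def_or q q' :
  qf_def q -> qf_def q' -> qf_def (fun v => q v || q' v).
Proof.
by move=> [f fP] [f' f'P]; exists (FOr f f') => v /=; rewrite fP f'P.
Qed.

Lemma qf_def_imply q q' :
  qf_def q -> qf_def q' -> qf_def (fun v => q v ==> q' v).
Proof.
move=> qP q'P; apply: eq_qf_def (qf_def_or (qf_def_not qP) q'P) => v.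
by rewrite implybE.
Qed.

Lemma qf_def_eqb q q' :
  qf_def q -> qf_def q' -> qf_def (fun v => q v == q' v).
Proof.
move=> qP q'P.
apply: eq_qf_def (qf_def_and (qf_def_imply qP q'P) (qf_def_imply q'P qP)) => v.
by case: (q v) (q' v) => [] [].
Qed.

Lemma qf_def_bool (b : bool) : qf_def (fun=> b).
Proof.
exists (if b then FEq (TCst V 0) (TCst V 0)
        else FNot (FEq (TCst V 0) (TCst V 0))) => v.
by case: b.
Qed.

Lemma qf_def_all (T : Type) (r : seq T) (q : T -> (V -> nat) -> bool) :
  (forall c, qf_def (q c)) -> qf_def (fun v => all (q^~ v) r).
Proof.
move=> qP; elim: r => [|c r IH] /=; first exact: qf_def_bool.
exact: qf_def_and.
Qed.

(** A quantifier over a finite index type is a finite conjunction and costs no bound variable. *)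
Lemma qf_def_forall (I : finType) (q : I -> (V -> nat) -> bool) :
  (forall i, qf_def (q i)) -> qf_def (fun v => [forall i, q i v]).
Proof.
move=> qP; apply: eq_qf_def (qf_def_all (enum I) qP) => v.
apply/allP/forallP => [h i|h i _]; last exact: h.
by apply: h; rewrite mem_enum.
Qed.

Lemma qf_def_exists (I : finType) (q : I -> (V -> nat) -> bool) :
  (forall i, qf_def (q i)) -> qf_def (fun v => [exists i, q i v]).
Proof.
move=> qP.
apply: eq_qf_def (qf_def_not (qf_def_forall (fun i => qf_def_not (qP i)))) => v.
by rewrite negb_forall; apply: eq_existsb => i; rewrite negbK.
Qed.

Definition nat_def (e : (V -> nat) -> nat) : Prop :=
  linear_def (fun v => (e v)%:R%R).

Lemma nat_def_cst (n : nat) : nat_def (fun=> n).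
Proof. exact: linear_def_cst. Qed.

Lemma nat_def_add (e e' : (V -> nat) -> nat) :
  nat_def e -> nat_def e' -> nat_def (fun v => e v + e' v).
Proof.
by move=> eP e'P; apply: eq_linear_def (linear_def_add eP e'P) => v; rewrite natrD.
Qed.

Lemma nat_def_mulr (e : (V -> nat) -> nat) (n : nat) :
  nat_def e -> nat_def (fun v => e v * n).
Proof.
move=> eP; apply: eq_linear_def (linear_def_scale n%:R eP) => v.
by rewrite mulnC natrM.
Qed.

Lemma nat_def_sum (I : finType) (A : pred I) (e : I -> (V -> nat) -> nat) :
  (forall i, nat_def (e i)) -> nat_def (fun v => \sum_(i | A i) e i v).
Proof.
by move=> eP; apply: eq_linear_def (linear_def_sum A eP) => v; rewrite natr_sum.
Qed.

Lemma qf_def_leq (e e' : (V -> nat) -> nat) :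
  nat_def e -> nat_def e' -> qf_def (fun v => e v <= e' v).
Proof.
by move=> eP e'P; apply: eq_qf_def (qf_def_le eP e'P) => v; rewrite ler_nat.
Qed.

Lemma qf_def_ltn (e e' : (V -> nat) -> nat) :
  nat_def e -> nat_def e' -> qf_def (fun v => e v < e' v).
Proof.
by move=> eP e'P; apply: qf_def_leq => //; apply: (nat_def_add (nat_def_cst 1)).
Qed.

Lemma qf_def_eqn (e e' : (V -> nat) -> nat) :
  nat_def e -> nat_def e' -> qf_def (fun v => e v == e' v).
Proof.
move=> eP e'P.
apply: eq_qf_def (qf_def_and (qf_def_leq eP e'P) (qf_def_leq e'P eP)) => v.
by rewrite eqn_leq.
Qed.

End Definability.

(** * Renaming the variables of a formula *)

Section Renaming.
Variables (V W : Type) (h : V -> W).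

Fixpoint lterm_map (t : lterm V) : lterm W :=
  match t with
  | TVar x => TVar (h x)
  | TCst c => TCst W c
  | TAdd t1 t2 => TAdd (lterm_map t1) (lterm_map t2)
  | TScale c t1 => TScale c (lterm_map t1)
  end.

Fixpoint qformula_map (f : qformula V) : qformula W :=
  match f with
  | FEq t1 t2 => FEq (lterm_map t1) (lterm_map t2)
  | FLe t1 t2 => FLe (lterm_map t1) (lterm_map t2)
  | FAnd f1 f2 => FAnd (qformula_map f1) (qformula_map f2)
  | FOr f1 f2 => FOr (qformula_map f1) (qformula_map f2)
  | FNot f1 => FNot (qformula_map f1)
  end.

Lemma lterm_eval_map (v : V -> nat) (w : W -> nat) (t : lterm V) :
  w \o h =1 v -> lterm_eval w (lterm_map t) = lterm_eval v t.
Proof.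
move=> wv; elim: t => [x|//|t1 IH1 t2 IH2|c t IH] /=.
- by rewrite -wv.
- by rewrite IH1 IH2.
- by rewrite IH.
Qed.

Lemma qformula_eval_map (v : V -> nat) (w : W -> nat) (f : qformula V) :
  w \o h =1 v -> qformula_eval w (qformula_map f) = qformula_eval v f.
Proof.
move=> wv; elim: f => [t t'|t t'|f IH f' IH'|f IH f' IH'|f IH] /=.
- by rewrite !(lterm_eval_map _ wv).
- by rewrite !(lterm_eval_map _ wv).
- by rewrite IH IH'.
- by rewrite IH IH'.
- by rewrite IH.
Qed.

End Renaming.

(** * Relations between configurations defined by existential formulas *)

Definition sum_val (A B : Type) (a : A -> nat) (b : B -> nat) (x : A + B) : nat :=
  match x with inl y => a y | inr z => b z end.

Section Relations.
Variables L G P : finType.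
Implicit Types s t : conf L G P.

Definition conf_coord : finType := (L + G + P)%type.

Definition conf_val s : conf_coord -> nat :=
  sum_val (sum_val (kappa s) (gval s)) (pval s).

Definition val_conf (v : conf_coord -> nat) : conf L G P :=
  Conf [ffun l => v (inl (inl l))] [ffun y => v (inl (inr y))]
       [ffun i => v (inr i)].

Lemma conf_ext s t :
  kappa s =1 kappa t -> gval s =1 gval t -> pval s =1 pval t -> s = t.
Proof.
by case: s t => [k g p] [k' g' p'] /= /ffunP-> /ffunP-> /ffunP->.
Qed.

Lemma val_confK s v : v =1 conf_val s -> val_conf v = s.
Proof. by move=> vs; apply: conf_ext => i; rewrite ffunE vs. Qed.

(** Bound variables are indexed by an arbitrary finite type, so that composition takes disjoint sums
    and needs no arithmetic on indices. *)
Definition rel_def (R : conf L G P -> conf L G P -> Prop) : Prop :=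
  exists (F : finType) (f : qformula (conf_coord + conf_coord + F)),
    forall s s', R s s' <->
      exists z : F -> nat,
        qformula_eval (sum_val (sum_val (conf_val s) (conf_val s')) z) f.

(** The coordinates of the middle configuration join the witnesses of both formulas as bound
    variables; [val_conf] turns any values of them back into a configuration. *)
Lemma rel_def_comp R R' : rel_def R -> rel_def R' ->
  rel_def (fun s s' => exists t, R s t /\ R' t s').
Proof.
move=> [F [f fP]] [F' [f' f'P]].
pose W := (conf_coord + conf_coord + (conf_coord + F + F'))%type.
pose h (x : conf_coord + conf_coord + F) : W :=
  match x with
  | inl (inl c) => inl (inl c)
  | inl (inr c) => inr (inl (inl c))
  | inr z => inr (inl (inr z))
  end.
pose h' (x : conf_coord + conf_coord + F') : W :=
  match x with
  | inl (inl c) => inr (inl (inl c))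
  | inl (inr c) => inl (inr c)
  | inr z => inr (inr z)
  end.
exists (conf_coord + F + F')%type, (FAnd (qformula_map h f) (qformula_map h' f')).
move=> s s'; split.
  move=> [t [/fP[z fz] /f'P[z' fz']]].
  exists (sum_val (sum_val (conf_val t) z) z') => /=; apply/andP; split.
    rewrite (@qformula_eval_map _ _ _
      (sum_val (sum_val (conf_val s) (conf_val t)) z)) //.
    by case=> [[c|c]|c].
  rewrite (@qformula_eval_map _ _ _
    (sum_val (sum_val (conf_val t) (conf_val s')) z')) //.
  by case=> [[c|c]|c].
move=> [z /= /andP[fz fz']].
exists (val_conf (fun c => z (inl (inl c)))); split.
  apply/fP; exists (fun c => z (inl (inr c))).
  apply: etrans fz; apply/esym/qformula_eval_map.
  by case=> [[c|c]|c] //=; case: c => [[?|?]|?] /=; rewrite ffunE.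
apply/f'P; exists (fun c => z (inr c)).
apply: etrans fz'; apply/esym/qformula_eval_map.
by case=> [[c|c]|c] //=; case: c => [[?|?]|?] /=; rewrite ffunE.
Qed.

Lemma rel_def_ex (F : finType) (b : conf L G P -> conf L G P -> (F -> nat) -> bool) :
  @qf_def (conf_coord + conf_coord + F) (fun v =>
    b (val_conf (v \o inl \o inl)) (val_conf (v \o inl \o inr)) (v \o inr)) ->
  rel_def (fun s s' => exists z, b s s' z).
Proof.
move=> [f fP]; exists F, f => s s'.
suff fb z : qformula_eval (sum_val (sum_val (conf_val s) (conf_val s')) z) f =
            b s s' z.
  by split=> -[z bz]; exists z; rewrite ?fb // -fb.
by rewrite fP; congr b; apply: val_confK.
Qed.

(** The six blocks of the encoding have lengths fixed by [L], [G] and [P], so the position of a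
    coordinate does not depend on the configurations. *)
Lemma encode2_coord (c : conf_coord + conf_coord) :
  exists i, forall s s',
    tnth (encode2 s s') i = sum_val (conf_val s) (conf_val s') c.
Proof.
have nthE (T : finType) (f : {ffun T -> nat}) x r :
    nth 0 (codom f ++ r) (enum_rank x) = f x.
  rewrite nth_cat size_codom ltn_ord (nth_map x) -?cardE ?ltn_ord //.
  by rewrite nth_enum_rank.
have nthD (T : finType) (f : {ffun T -> nat}) n r :
    nth 0 (codom f ++ r) (#|T| + n) = nth 0 r n.
  by rewrite nth_cat size_codom ltnNge leq_addr /= addKn.
have nthP n : (exists s0 s0' : conf L G P, n < size (encode s0 ++ encode s0')) ->
    exists i, forall s s' : conf L G P,
      tnth (encode2 s s') i = nth 0 (encode s ++ encode s') n.
  move=> [s0 [s0' ltn]]; rewrite (eqP (size_encode2 s0 s0')) in ltn.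
  by exists (Ordinal ltn) => s s'; rewrite (tnth_nth 0).
suff [n nE] : exists n, forall s s', nth 0 (encode s ++ encode s') n =
    sum_val (conf_val s) (conf_val s') c /\ n < size (encode s ++ encode s').
  (* Any configuration will do here: it only serves to bound [n] by the size of the encoding, which
     is constant. *)
  pose s0 : conf L G P := Conf [ffun=> 0] [ffun=> 0] [ffun=> 0].
  have [|i iE] := nthP n; first by exists s0, s0; have [] := nE s0 s0.
  by exists i => s s'; rewrite iE; have [] := nE s s'.
case: c => [] [[l|y]|i].
- exists (enum_rank l) => s s'; rewrite /encode -!catA nthE; split=> //.
  by rewrite !size_cat !size_codom ltn_addr.
- exists (#|L| + enum_rank y) => s s'; rewrite /encode -!catA nthD nthE.
  by split=> //; rewrite !size_cat !size_codom ltn_add2l ltn_addr.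
- exists (#|L| + (#|G| + enum_rank i)) => s s'.
  rewrite /encode -!catA !nthD nthE.
  by split=> //; rewrite !size_cat !size_codom !ltn_add2l ltn_addr.
- exists (#|L| + (#|G| + (#|P| + enum_rank l))) => s s'.
  rewrite /encode -!catA !nthD nthE.
  by split=> //; rewrite !size_cat !size_codom !ltn_add2l ltn_addr.
- exists (#|L| + (#|G| + (#|P| + (#|L| + enum_rank y)))) => s s'.
  rewrite /encode -!catA !nthD nthE.
  by split=> //; rewrite !size_cat !size_codom !ltn_add2l ltn_addr.
- exists (#|L| + (#|G| + (#|P| + (#|L| + (#|G| + enum_rank i))))) => s s'.
  (* The last block has no tail, so an empty one is appended to match [nthE]. *)
  rewrite /encode -!catA !nthD -[codom _]cats0 nthE.
  by split=> //; rewrite !size_cat !size_codom !ltn_add2l addn0.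
Qed.

(** Free coordinates are renamed to their positions in the tuple, and bound variables to their ranks
    in the enumeration of [F]. *)
Lemma rel_def_epformula R : rel_def R ->
  exists phi : epformula 'I_(2 * #|L| + 2 * #|G| + 2 * #|P|),
    forall s s', ep_sat (tnth (encode2 s s')) phi <-> R s s'.
Proof.
move=> [F [f fP]]; have [c cE] := fin_all_exists encode2_coord.
pose h (x : conf_coord + conf_coord + F) :
    'I_(2 * #|L| + 2 * #|G| + 2 * #|P|) + 'I_#|F| :=
  match x with inl y => inl (c y) | inr z => inr (enum_rank z) end.
exists (EPFormula (qformula_map h f)) => s s'; split.
  move=> [z /= fz]; apply/fP; exists (fun i => z (enum_rank i)).
  apply: etrans fz; apply/esym/qformula_eval_map.
  by case=> //= y; rewrite cE.
move=> /fP[z fz]; exists (fun i => z (enum_val i)) => /=.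
rewrite (@qformula_eval_map _ _ h
  (sum_val (sum_val (conf_val s) (conf_val s')) z)) //.
by case=> /= y; rewrite ?cE ?enum_rankK.
Qed.

End Relations.

(** * Firing counts, and when they are realized by a run *)

Section Automaton.
Variables L G P : finType.
Variable TA : threshold_automaton L G P.
Implicit Types s t : conf L G P.

(** As a finite type, the rules of [TA] can index sums and the variables for the firing counts. *)
Definition trule : finType := seq_sub (ta_rules TA).
Implicit Types (x : trule -> nat) (d : L -> nat) (r : trule).

Definition src r : L := r_from (val r).
Definition dst r : L := r_to (val r).

(** Kirchhoff's law at each location, with the outflow moved to the left to avoid truncated
    subtraction. *)
Definition flow s s' x : bool :=
  [forall l, kappa s' l + \sum_r x r * (src r == l) ==
             kappa s l + \sum_r x r * (dst r == l)].

Definition shared_flow s s' x : bool :=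
  [forall y, gval s' y == gval s y + \sum_r x r * r_upd (val r) y].

(** Flow equations alone admit a cycle of used rules that no process ever enters. Following links
    backwards decreases the rank [d], so under [connected] the chain must end at an initially
    occupied location. *)
Definition linked s x d (l : L) : bool :=
  (0 < kappa s l) ||
  [exists r, [&& 0 < x r, dst r == l & d (src r) < d l]].

Definition connected s x d : bool :=
  [forall r, (0 < x r) ==> linked s x d (src r)].

Definition add_rule x r : trule -> nat := fun r1 => x r1 + (r1 == r).

Definition sub_rule x r : trule -> nat := fun r1 => x r1 - (r1 == r).

Lemma sum_add_rule x r (w : trule -> nat) :
  \sum_r1 add_rule x r r1 * w r1 = \sum_r1 x r1 * w r1 + w r.
Proof.
under eq_bigr do rewrite mulnDl.
rewrite big_split /=; congr (_ + _).
rewrite (bigD1 r) //= eqxx mul1n big1 ?addn0 // => r1 /negPf->.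
by rewrite mul0n.
Qed.

Lemma sum_sub_rule x r (w : trule -> nat) : 0 < x r ->
  \sum_r1 x r1 * w r1 = \sum_r1 sub_rule x r r1 * w r1 + w r.
Proof.
move=> xr; rewrite -sum_add_rule; apply: eq_bigr => r1 _.
by rewrite /add_rule /sub_rule; case: eqP => [->|]; rewrite ?subnK ?subn0 ?addn0.
Qed.

Lemma sum_gt0 (x w : trule -> nat) :
  0 < \sum_r x r * w r -> exists2 r, 0 < x r & 0 < w r.
Proof.
rewrite lt0n sum_nat_eq0 negb_forall => /existsP[r].
by rewrite /= muln_eq0 negb_or -!lt0n => /andP[]; exists r.
Qed.

Lemma sum_pos (x w : trule -> nat) r :
  0 < x r -> 0 < w r -> 0 < \sum_r x r * w r.
Proof. by move=> xr wr; rewrite (bigD1 r) //= addn_gt0 muln_gt0 xr wr. Qed.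

Lemma sum_fiber x (f : trule -> L) :
  \sum_l \sum_r x r * (f r == l) = \sum_r x r.
Proof.
rewrite exchange_big; apply: eq_bigr => r _ /=.
rewrite (bigD1 (f r)) //= eqxx muln1 big1 ?addn0 // => l.
by rewrite eq_sym => /negPf->; rewrite muln0.
Qed.

(* Otherwise every location would have inflow at most outflow, hence equal,   *)
(* so no used rule would leave an initially occupied location.                *)
Lemma last_location s s' x d : flow s s' x -> connected s x d ->
  0 < \sum_r x r -> exists2 r, 0 < x r & 0 < kappa s' (dst r).
Proof.
move=> /forallP fl /forallP co x0.
case: (boolP [exists r, (0 < x r) && (0 < kappa s' (dst r))]).
  by move=> /existsP[r /andP[]]; exists r.
rewrite negb_exists => /forallP none; exfalso.
pose inn l := \sum_r x r * (dst r == l).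
pose out l := \sum_r x r * (src r == l).
have flE l : kappa s' l + out l = kappa s l + inn l by exact/eqP/fl.
have k0 l : 0 < inn l -> kappa s' l = 0.
  move=> /sum_gt0[r xr]; rewrite lt0b => /eqP<-.
  by have := none r; rewrite xr /= lt0n negbK => /eqP.
have le_io l : inn l <= out l.
  have [->//|i0] := posnP (inn l).
  by have := flE l; rewrite k0 //; lia.
have eq_io l : inn l = out l.
  (* Summed over all locations, inflow and outflow both count every firing once, so the inequalities
     [le_io] are equalities. *)
  have : \sum_l (out l - inn l) = 0.
    by rewrite sumnB // /inn /out !sum_fiber subnn.
  move=> /eqP; rewrite sum_nat_eq0 => /forallP/(_ l)/=.
  by have := le_io l; lia.
(* Descent on the rank: the source of a used rule has outflow, hence inflow, hence is empty in [s']
   and by the flow equation also in [s]; so it is linked to a used rule whose source has smaller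
   rank. *)
have no_use n r : d (src r) < n -> x r = 0.
  elim: n r => // n IH r dn; apply/eqP; rewrite -leqn0 leqNgt; apply/negP => xr.
  have o0 : 0 < out (src r) by rewrite (sum_pos (r := r)) // eqxx.
  have ks : kappa s (src r) = 0.
    by have := flE (src r); have := k0 (src r); have := eq_io (src r); lia.
  have := co r; rewrite xr /linked ks /= => /existsP[r' /and3P[xr' _ lt]].
  by have := IH r'; move: xr' lt dn; lia.
move: x0; rewrite big1 // => r _; exact: no_use (ltnSn _).
Qed.

(** Dropping one firing of [r] can only break links into [dst r], so only the rules leaving that
    location have to be checked again. *)
Lemma connected_sub s x d r :
  connected s x d ->
  (0 < \sum_r1 sub_rule x r r1 * (src r1 == dst r) ->
   linked s (sub_rule x r) d (dst r)) ->
  connected s (sub_rule x r) d.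
Proof.
move=> /forallP co li; apply/forallP => r1; apply/implyP => xr1.
have [e|ne] := eqVneq (src r1) (dst r).
  by rewrite e; apply: li; rewrite (sum_pos (r := r1)) // e eqxx.
have := co r1; rewrite (leq_trans xr1 (leq_subr _ _)) /= /linked.
case: (0 < kappa s _) => //= /existsP[r' /and3P[xr' e lt]].
apply/existsP; exists r'; rewrite e lt !andbT /sub_rule.
case: (eqVneq r' r) => [rr|]; last by rewrite subn0.
by rewrite -(eqP e) rr eqxx in ne.
Qed.

(* If the location l entered last must still be left by a used rule and was   *)
(* initially empty, then it is entered at least twice, and its connecting     *)
(* rule can be kept.                                                          *)
Lemma last_rule s s' x d : flow s s' x -> connected s x d ->
  0 < \sum_r x r ->
  exists r, [/\ 0 < x r, 0 < kappa s' (dst r) & connected s (sub_rule x r) d].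
Proof.
move=> fl co x0; have [r0 xr0 k0] := last_location fl co x0.
set l := dst r0 in k0.
case: (boolP ((0 < kappa s l) || (\sum_r x r * (src r == l) == 0))) => [triv|].
  exists r0; split=> //; apply: connected_sub => //.
  rewrite -/l; case/orP: triv => [ks _|/eqP o0]; first by rewrite /linked ks.
  move=> /sum_gt0[r1 xr1 w1]; suff: 0 < 0 by [].
  rewrite -{2}o0 (sum_pos (r := r1)) //.
  exact: leq_trans xr1 (leq_subr _ _).
rewrite negb_or -leqNgt leqn0 -lt0n => /andP[/eqP ks out0].
have /sum_gt0[r1 xr1] := out0; rewrite lt0b => /eqP sr1.
have /forallP/(_ r1) := co; rewrite xr1 /linked sr1 ks /=.
move=> /existsP[r' /and3P[xr' /eqP dr' lt]].
have [r [xr dr xr'']] : exists r, [/\ 0 < x r, dst r = l & 0 < sub_rule x r r'].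
  have [x2|x1] := ltnP 1 (x r').
    by exists r'; rewrite /sub_rule eqxx subn_gt0.
  have := eqP (forallP fl l); rewrite ks.
  rewrite (sum_sub_rule (r := r') (fun r => dst r == l)) // dr' eqxx => e.
  have /sum_gt0[r xr] : 0 < \sum_r1 sub_rule x r' r1 * (dst r1 == l).
    by move: e k0 out0; lia.
  rewrite lt0b => /eqP dr; exists r; split=> //.
    exact: leq_trans xr (leq_subr _ _).
  move: xr; rewrite /sub_rule (eq_sym r'); case: eqP => [->|]; last by lia.
  by move: x1; lia.
exists r; rewrite dr; split=> //; apply: connected_sub => // _.
rewrite dr /linked; apply/orP; right; apply/existsP; exists r'.
by rewrite xr'' dr' eqxx.
Qed.

(** A [Rise] guard is inherited upwards from [s], a [Fall] guard downwards from [s']. *)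
Lemma guard_between s t s' (c : guard G P) :
  pval t = pval s -> pval s' = pval s ->
  (forall y, gval s y <= gval t y <= gval s' y) ->
  guard_holds s c -> guard_holds s' c -> guard_holds t c.
Proof.
move=> pt ps' le; case: c => y a0 a /=; rewrite /threshold pt ps'.
  by move=> h _; apply: le_trans h _; rewrite ler_nat; case/andP: (le y).
by move=> _; apply: le_lt_trans; rewrite ler_nat; case/andP: (le y).
Qed.

Lemma reachable_trans s t s' :
  reachable TA s t -> reachable TA t s' -> reachable TA s s'.
Proof.
move=> [rs rsP] [rs' rs'P]; exists (rs ++ rs').
elim: rs s rsP => [|r rs IH] s /=; first by move=> ->.
by move=> [? ? /IH].
Qed.

Lemma reachable_step s r : enabled s (val r) -> reachable TA s (fire (val r) s).
Proof. by move=> en; exists [:: val r]; split=> //; apply: valP. Qed.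

(** The run is built from its end, by induction on the number of firings. The start [s] stays fixed,
    so the same rank [d] keeps certifying connectivity, and guards that hold at both ends also hold
    at the new end point by [guard_between]. *)
Lemma realize s s' x d : pval s' = pval s ->
  flow s s' x -> shared_flow s s' x -> connected s x d ->
  (forall r, 0 < x r -> all (guard_holds s) (r_guard (val r))) ->
  (forall r, 0 < x r -> all (guard_holds s') (r_guard (val r))) ->
  reachable TA s s'.
Proof.
move En: (\sum_r x r) => n; elim: n x s' En => [|n IH] x s' En.
  move=> ps fl sf _ _ _; exists [::]; have x0 r : x r = 0.
    by move/eqP: En; rewrite sum_nat_eq0 => /forallP/(_ r)/eqP.
  apply: conf_ext => i; last by rewrite ps.
    have := eqP (forallP fl i); rewrite !big1 ?addn0 // => r _; by rewrite x0.
  by have := eqP (forallP sf i); rewrite big1 ?addn0 // => r _; rewrite x0.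
move=> ps fl sf co gs gs'.
have [|r [xr kr co']] := last_rule fl co; first by rewrite En.
(* [t] undoes the last firing of [r]. The subtractions are exact: [dst r] is occupied in [s'], and
   each shared value of [s'] includes the update of [r]. *)
pose t : conf L G P := Conf [ffun l => kappa s' l - (l == dst r) + (l == src r)]
  [ffun y => gval s' y - r_upd (val r) y] (pval s').
have fl' : flow s t (sub_rule x r).
  apply/forallP => l; have := eqP (forallP fl l).
  rewrite !(sum_sub_rule (r := r) _ xr) ffunE !(eq_sym l).
  by case: (eqVneq (dst r) l) kr => [->|] kr /=; lia.
have sfE y : gval s' y =
    gval s y + \sum_r1 sub_rule x r r1 * r_upd (val r1) y + r_upd (val r) y.
  by rewrite (eqP (forallP sf y)) (sum_sub_rule (r := r) _ xr) addnA.
have sf' : shared_flow s t (sub_rule x r).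
  by apply/forallP => y; rewrite ffunE sfE addnK.
have x'x r1 : 0 < sub_rule x r r1 -> 0 < x r1.
  by move=> h; apply: leq_trans h (leq_subr _ _).
have gt r1 : 0 < x r1 -> all (guard_holds t) (r_guard (val r1)).
  move=> xr1; apply/allP => c cr1.
  apply: (@guard_between s t s') => //.
  - by move=> y; rewrite ffunE sfE addnK leq_addr /= leq_addr.
  - exact: (allP (gs r1 xr1)).
  - exact: (allP (gs' r1 xr1)).
have En' : \sum_r1 sub_rule x r r1 = n.
  have := sum_sub_rule (fun=> 1) xr.
  rewrite -!big_distrl /= En; lia.
apply: (reachable_trans (t := t)).
  by apply: (IH (sub_rule x r)) => // r1 /x'x; [apply: gs | apply: gt].
have -> : s' = fire (val r) t.
  apply: conf_ext => i //=; rewrite !ffunE; last by rewrite sfE addnK.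
  by rewrite -/(src r) -/(dst r); case: (eqVneq i (dst r)) => [->|] /=; lia.
apply: reachable_step; rewrite /enabled gt // andbT ffunE /= eqxx.
by rewrite addn1.
Qed.

(** * Steady segments, single steps and their alternation *)

Definition guards : seq (guard G P) := flatten [seq r_guard q | q <- ta_rules TA].

Lemma mem_guards r c : c \in r_guard (val r) -> c \in guards.
Proof. by move=> cr; apply/flatten_mapP; exists (val r) => //; apply: valP. Qed.

(** Comparing the end points suffices for a segment: by [guard_between], a guard that holds at both
    of them holds in between. *)
Definition same_context s s' : bool :=
  all (fun c => guard_holds s c == guard_holds s' c) guards.

Definition used_guards s x : bool :=
  [forall r, (0 < x r) ==> all (guard_holds s) (r_guard (val r))].

Definition same_params s s' : bool := [forall i, pval s' i == pval s i].

Definition steady s s' (z : trule + L -> nat) : bool :=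
  [&& same_params s s', flow s s' (z \o inl), shared_flow s s' (z \o inl),
      same_context s s', used_guards s (z \o inl) &
      connected s (z \o inl) (z \o inr)].

(** The equation [s' = fire (val r) s] is spelled out coordinatewise without subtraction, as linear
    equations. *)
Definition step s s' : bool :=
  [exists r : trule,
    [&& enabled s (val r), same_params s s',
        [forall l, kappa s' l + (l == src r) == kappa s l + (l == dst r)] &
        [forall y, gval s' y == gval s y + r_upd (val r) y]]].

Definition steady_rel s s' : Prop := exists z, steady s s' z.

(** The steady alternative lets a level of [alternation] stay idle, so that a fixed number of levels
    also covers runs with fewer context changes. *)
Definition steady_or_step s s' : Prop := exists z, steady s s' z || step s s'.

Fixpoint alternation (n : nat) s s' : Prop :=
  if n is n'.+1 then
    exists t, steady_rel s t /\
      exists t', steady_or_step t t' /\ alternation n' t' s'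
  else steady_rel s s'.

Lemma steady_reachable s s' : steady_rel s s' -> reachable TA s s'.
Proof.
move=> [z /and5P[/forallP ps fl sf ctx /andP[/forallP ug co]]].
have ps' : pval s' = pval s by apply/ffunP => i; apply/eqP.
have gs r : 0 < (z \o inl) r -> all (guard_holds s) (r_guard (val r)).
  by move=> zr; have := ug r; rewrite zr.
apply: (realize ps' fl sf co gs) => r /gs /allP gr; apply/allP => c cr.
by rewrite -(eqP (allP ctx c (mem_guards cr))) gr.
Qed.

Lemma stepP s s' :
  reflect (exists2 r : trule, enabled s (val r) & s' = fire (val r) s) (step s s').
Proof.
apply: (iffP existsP) => -[r].
  move=> /and4P[en /forallP ps /forallP ks /forallP gs]; exists r => //.
  case/andP: (en) => k0 _.
  apply: conf_ext => i /=; rewrite ?ffunE; try exact/eqP.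
  have := eqP (ks i); rewrite -/(src r) -/(dst r).
  by move: k0; rewrite -/(src r); case: (eqVneq i (src r)) => [->|] /=; lia.
move=> en ->; exists r; rewrite en /=; case/andP: (en) => k0 _.
apply/and3P; split; apply/forallP => i //=; rewrite ffunE //.
rewrite -/(src r) -/(dst r).
by move: k0; rewrite -/(src r); case: (eqVneq i (src r)) => [->|] /=; lia.
Qed.

Lemma alternation_reachable n s s' : alternation n s s' -> reachable TA s s'.
Proof.
elim: n s => [|n IH] s /=; first exact: steady_reachable.
move=> [t [/steady_reachable st [t' [[z tt'] /IH]]]].
apply: reachable_trans; apply: reachable_trans st _.
case/orP: tt' => [zP|/stepP[r en ->]]; last exact: reachable_step.
by apply: steady_reachable; exists z.
Qed.

(** * Every run is an alternation of bounded length *)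

Lemma steady_refl s : steady_rel s s.
Proof.
exists (fun=> 0); apply/and5P; split; last apply/andP; try split.
- by apply/forallP.
- by apply/forallP => l; rewrite !big1.
- by apply/forallP => y; rewrite big1 ?addn0.
- by apply/allP.
- by apply/forallP.
- by apply/forallP.
Qed.

(** The new first firing adds one to the count of [r], and the ranks must be rebuilt because [s] and
    [fire (val r) s] may occupy different locations. *)
Lemma steady_cons s r t : enabled s (val r) ->
  same_context s (fire (val r) s) ->
  steady_rel (fire (val r) s) t -> steady_rel s t.
Proof.
set s1 := fire _ _ => /andP[k0 gr] ctx.
move=> [z /and5P[/forallP ps /forallP fl /forallP sf ctx1]].
move=> /andP[/forallP ug /forallP co].
pose x := z \o inl; pose d := z \o inr.
(* Locations occupied in [s] get rank 0 and all others move up by one. Old links survive, and a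
   location first occupied by firing [r] is linked through [r], whose source has rank 0. *)
pose d1 l := if 0 < kappa s l then 0 else (d l).+1.
have ctxE c : c \in guards -> guard_holds s c = guard_holds s1 c.
  by move/(allP ctx)/eqP.
exists (sum_val (add_rule x r) d1).
apply/and5P; split; last apply/andP; try split.
- by apply/forallP => i; apply: ps.
- apply/forallP => l; rewrite /comp /= !sum_add_rule.
  have := eqP (fl l); rewrite ffunE -/(src r) -/(dst r) !(eq_sym l) -/x.
  move: k0; rewrite -/(src r).
  by case: (eqVneq (src r) l) => [->|_] /=; lia.
- apply/forallP => y; rewrite /comp /= sum_add_rule.
  by rewrite (eqP (sf y)) ffunE addnAC addnA.
- by apply/allP => c cg; rewrite ctxE //; apply: (allP ctx1).
- apply/forallP => r1; apply/implyP; rewrite /= /add_rule.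
  case: eqP => [->//|_]; rewrite addn0 => xr1.
  have /allP g1 := implyP (ug r1) xr1.
  by apply/allP => c cr1; rewrite ctxE ?g1 // (mem_guards cr1).
apply/forallP => r1; apply/implyP; rewrite /= /linked => xr1.
have [//|ks] := boolP (0 < kappa s (src r1)) => /=.
have r1r : r1 != r by apply: contraNneq ks => ->.
have {}xr1 : 0 < x r1 by move: xr1; rewrite /add_rule (negPf r1r) addn0.
have := implyP (co r1) xr1; rewrite /linked => /orP[k1|].
  apply/existsP; exists r; rewrite /= /add_rule eqxx addn1 /d1 k0 (negPf ks) andbT.
  move: k1; rewrite ffunE -/(dst r) (eq_sym (dst r)).
  case: (src r1 == dst r) => //; rewrite addn0.
  by move=> /leq_trans/(_ (leq_subr _ _)); rewrite (negPf ks).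
move=> /existsP[r' /and3P[xr' e lt]]; apply/existsP; exists r'.
rewrite /= /add_rule addn_gt0 xr' e /= /d1 (negPf ks).
by case: ifP => // _; rewrite ltnS.
Qed.

(* An unsettled guard may still change its truth value, a settled one cannot. *)
Definition unsettled s (c : guard G P) : bool :=
  if c is Rise _ _ _ then ~~ guard_holds s c else guard_holds s c.

Lemma unsettled_fire s r c : unsettled (fire (val r) s) c -> unsettled s c.
Proof.
case: c => y a0 a /=; rewrite /threshold /= ffunE.
  apply: contraNN => h; apply: le_trans h _; by rewrite ler_nat leq_addr.
by apply: le_lt_trans; rewrite ler_nat leq_addr.
Qed.

Lemma unsettled_eq s t c :
  (guard_holds s c == guard_holds t c) = (unsettled s c == unsettled t c).
Proof. by case: c => y a0 a //=; rewrite (inj_eq negb_inj). Qed.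

Lemma count_lt (T : eqType) (a b : pred T) (e : seq T) : subpred a b ->
  has (fun c => b c && ~~ a c) e -> count a e < count b e.
Proof.
move=> ab; elim: e => //= c e IH /orP[/andP[-> /negPf->]|/IH lt].
  exact: sub_count ab e.
have := ab c; case: (a c) => [/(_ isT)->|_] /=; first by rewrite ltn_add2l.
exact: leq_trans lt (leq_addl _ _).
Qed.

(** A guard that changes its truth value leaves the set of unsettled guards and none ever enters it,
    so their number bounds the context changes still to come. *)
Lemma unsettled_lt s r : ~~ same_context s (fire (val r) s) ->
  count (unsettled (fire (val r) s)) guards < count (unsettled s) guards.
Proof.
rewrite -has_predC => ne; apply: count_lt => [c|]; first exact: unsettled_fire.
apply: sub_has ne => c /=; rewrite unsettled_eq.
by have := @unsettled_fire s r c; case: (unsettled s c) (unsettled _ c) => [] [] // ->.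
Qed.

(** A step that keeps the context is absorbed by the first steady segment of the remaining run; a
    step that changes it uses up one level, paid for by [unsettled_lt]. *)
Lemma run_alternation n rs s s' :
  run TA s rs s' -> count (unsettled s) guards <= n -> alternation n s s'.
Proof.
(* Levels left over at the end of the run are filled with empty segments. *)
have alt_refl m t : alternation m t t.
  elim: m => [|m IH] /=; first exact: steady_refl.
  exists t; split; first exact: steady_refl.
  by have [z zP] := steady_refl t; exists t; split=> //; exists z; rewrite zP.
elim: rs n s => [|r0 rs IH] n s /=; first by move=> ->.
move=> [r0TA]; rewrite -[r0]/(val (SeqSub r0TA)); move: (SeqSub r0TA) => r en.
move=> /IH {}IH le_n.
case: (boolP (same_context s (fire (val r) s))) => [ctx|/unsettled_lt lt].
  have := IH n; case: n {IH} le_n => [|n] le_n /= IH.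
    apply: steady_cons en ctx (IH _); apply: leq_trans le_n.
    by apply: sub_count => c; apply: unsettled_fire.
  have [|t [st tt]] := IH.
    by apply: leq_trans le_n; apply: sub_count => c; apply: unsettled_fire.
  by exists t; split=> //; apply: steady_cons en ctx st.
case: n le_n => [|n] le_n /=; first by have := leq_trans lt le_n.
exists s; split; first exact: steady_refl.
exists (fire (val r) s); split; last exact: IH (leq_trans lt le_n).
by exists (fun=> 0); apply/orP; right; apply/stepP; exists r.
Qed.

Lemma reachableP s s' : reachable TA s s' <-> alternation (size guards) s s'.
Proof.
split; last exact: alternation_reachable.
by move=> [rs /run_alternation]; apply; apply: count_size.
Qed.

(** * Quantifier-free definability of segments and steps *)

Section Define.
Variables (V : Type) (e e' : conf_coord L G P -> V) (fz : trule + L -> V).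

Let cf (v : V -> nat) := val_conf (v \o e).
Let cf' (v : V -> nat) := val_conf (v \o e').

Lemma nat_def_kappa (f : conf_coord L G P -> V) l :
  nat_def (fun v => kappa (val_conf (v \o f)) l).
Proof. by apply: eq_linear_def (linear_def_var _) => v; rewrite ffunE. Qed.

Lemma nat_def_gval (f : conf_coord L G P -> V) y :
  nat_def (fun v => gval (val_conf (v \o f)) y).
Proof. by apply: eq_linear_def (linear_def_var _) => v; rewrite ffunE. Qed.

Lemma nat_def_pval (f : conf_coord L G P -> V) i :
  nat_def (fun v => pval (val_conf (v \o f)) i).
Proof. by apply: eq_linear_def (linear_def_var _) => v; rewrite ffunE. Qed.

Lemma qf_def_guard (f : conf_coord L G P -> V) c :
  qf_def (fun v => guard_holds (val_conf (v \o f)) c).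
Proof.
have th a0 a : linear_def (fun v => threshold (val_conf (v \o f)) a0 a).
  apply: linear_def_add (linear_def_cst _ _) _; apply: linear_def_sum => i.
  exact: linear_def_scale (nat_def_pval f i).
case: c => y a0 a; first exact: qf_def_le (th _ _) (nat_def_gval f y).
apply: eq_qf_def (qf_def_not (qf_def_le (th a0 a) (nat_def_gval f y))) => v /=.
by rewrite ltNge.
Qed.

Lemma qf_def_guards (f : conf_coord L G P -> V) r :
  qf_def (fun v => all (guard_holds (val_conf (v \o f))) (r_guard (val r))).
Proof. by apply: qf_def_all => c; apply: qf_def_guard. Qed.

Lemma nat_def_var (y : V) : nat_def (fun v => v y).
Proof. exact: linear_def_var. Qed.

Lemma qf_def_same_params : qf_def (fun v => same_params (cf v) (cf' v)).
Proof.
by apply: qf_def_forall => i; apply: qf_def_eqn; apply: nat_def_pval.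
Qed.

(** Every product in the flow equations is a firing count times a constant determined by [TA], and
    ranks are only compared with each other, so all the atoms are linear. *)
Lemma qf_def_steady : qf_def (fun v =>
  steady (cf v) (cf' v) (v \o fz)).
Proof.
have pos y : qf_def (fun v : V -> nat => 0 < v y).
  exact: qf_def_ltn (nat_def_cst _ 0) (nat_def_var _).
apply: qf_def_and qf_def_same_params _.
apply: qf_def_and.
  apply: qf_def_forall => l; apply: qf_def_eqn; apply: nat_def_add;
  by [apply: nat_def_kappa | apply: nat_def_sum => r; apply: nat_def_mulr (nat_def_var _)].
apply: qf_def_and.
  apply: qf_def_forall => y; apply: qf_def_eqn (nat_def_gval _ _) _.
  apply: nat_def_add (nat_def_gval _ _) _.
  by apply: nat_def_sum => r; apply: nat_def_mulr (nat_def_var _).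
apply: qf_def_and.
  by apply: qf_def_all => c; apply: qf_def_eqb; apply: qf_def_guard.
apply: qf_def_and.
  by apply: qf_def_forall => r; apply: qf_def_imply (pos _) (qf_def_guards _ _).
apply: qf_def_forall => r; apply: qf_def_imply (pos _) _.
apply: qf_def_or.
  exact: qf_def_ltn (nat_def_cst _ 0) (nat_def_kappa _ _).
apply: qf_def_exists => r'; apply: qf_def_and (pos _) _.
apply: qf_def_and (qf_def_bool _ _) _.
exact: qf_def_ltn (nat_def_var _) (nat_def_var _).
Qed.

Lemma qf_def_step : qf_def (fun v => step (cf v) (cf' v)).
Proof.
apply: qf_def_exists => r; apply: qf_def_and.
  apply: qf_def_and (qf_def_guards _ _).
  exact: qf_def_ltn (nat_def_cst _ 0) (nat_def_kappa _ _).
apply: qf_def_and qf_def_same_params _; apply: qf_def_and.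
  apply: qf_def_forall => l; apply: qf_def_eqn;
  exact: nat_def_add (nat_def_kappa _ _) (nat_def_cst _ _).
apply: qf_def_forall => y; apply: qf_def_eqn (nat_def_gval _ _) _.
exact: nat_def_add (nat_def_gval _ _) (nat_def_cst _ _).
Qed.

End Define.

Lemma rel_def_steady : rel_def steady_rel.
Proof.
apply: rel_def_ex.
exact: qf_def_steady.
Qed.

Lemma rel_def_steady_or_step : rel_def steady_or_step.
Proof.
apply: (@rel_def_ex _ _ _ _ (fun s s' z => steady s s' z || step s s')).
apply: qf_def_or; last exact: qf_def_step.
exact: qf_def_steady.
Qed.

Lemma rel_def_alternation n : rel_def (alternation n).
Proof.
elim: n => [|n IH] /=; first exact: rel_def_steady.
apply: rel_def_comp rel_def_steady _.
exact: rel_def_comp rel_def_steady_or_step IH.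
Qed.

End Automaton.

Theorem theorem5 (L G P : finType) (E : environment P)
    (TA : threshold_automaton L G P) :
  exists phi_reach : epformula 'I_(2 * #|L| + 2 * #|G| + 2 * #|P|),
    forall s s' : conf L G P,
      is_configuration E s -> is_configuration E s' ->
      (ep_sat (tnth (encode2 s s')) phi_reach <-> reachable TA s s').
Proof.
(* The number of levels depends on [TA] alone, so a single formula serves all pairs of
   configurations. *)
have [phi phiP] := rel_def_epformula (rel_def_alternation TA (size (guards TA))).
by exists phi => s s' _ _; rewrite phiP; split=> /reachableP.
Qed.
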